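(* Let $1<p<\infty$, let $r,s\in\mathbb{C}$, and let $U(s,r,s)$ be the bounded linear operator on $\ell_p$ defined by the symmetric tri-band matrix with $r$ on the main diagonal and $s$ on the first super- and sub-diagonals. Then the spectrum of $U(s,r,s)$ on $\ell_p$ is $$\sigma\left(U(s,r,s),\ell_p\right)=[r-2s,\,r+2s],$$ where $[r-2s,r+2s]=\{r+2s\cos\theta:\theta\in[0,2\pi]\}$ is the line segment in $\mathbb{C}$ joining $r-2s$ and $r+2s$.
   Context: $\mathbb{N}=\{0,1,2,\dots\}$. $\ell_p$ is the complex Banach space of sequences $x=(x_k)_{k\in\mathbb{N}}$ with $\sum_k|x_k|^p<\infty$, with its usual norm. The operator $U(s,r,s)$ acts by $(U(s,r,s)x)_k=sx_{k-1}+rx_k+sx_{k+1}$ for $k\in\mathbb{N}$, with the convention $x_{-1}=0$. For a bounded linear operator $T$ on a complex Banach space $X$, a regular value is a $\lambda\in\mathbb{C}$ such that (R1) $(T-\lambda I)^{-1}$ exists (i.e. $T-\lambda I$ is injective), (R2) it is bounded, (R3) it is defined on a dense subset of $X$ (i.e. the range of $T-\lambda I$ is dense). The spectrum $\sigma(T,X)$ is the set of all $\lambda\in\mathbb{C}$ that are not regular values. *)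

(* Defs.v *)
From HB Require Import structures.
From mathcomp Require Import all_boot all_order all_algebra.
From mathcomp Require Import complex.
From mathcomp Require Import all_classical all_reals all_analysis.
From mathcomp Require Import ring.

Set Implicit Arguments.
Unset Strict Implicit.
Unset Printing Implicit Defensive.

Import Order.TTheory GRing.Theory Num.Theory.
Import numFieldNormedType.Exports.
Import Normc.

Local Open Scope classical_set_scope.
Local Open Scope complex_scope.
Local Open Scope ring_scope.

(* `normc z : R` is the modulus of z; the norm `|z| is its image in R[i].
   lp_sum and lp_norm are locked because conversion problems such as
   lp_norm p x =?= lp_norm p y would otherwise unfold powR and the limits. *)
HB.lock Definition lp_sum (R : realType) (p : R) (x : nat -> R[i]) : \bar R :=
  (\sum_(0 <= k <oo) (normc (x k) `^ p)%:E)%E.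
Canonical lp_sum_unlockable := Unlockable lp_sum.unlock.

(* The argument p1 only serves to attach the instances below, which need it. *)
Definition lp (R : realType) (p : R) (p1 : 1 <= p) : {pred nat -> R[i]} :=
  fun x => `[< (lp_sum p x < +oo)%E >].

HB.lock Definition lp_norm (R : realType) (p : R) (x : nat -> R[i]) : R :=
  fine (lp_sum p x) `^ p^-1.
Canonical lp_norm_unlockable := Unlockable lp_norm.unlock.

Section lp_facts.
Context {R : realType} (p : R) (p1 : 1 <= p).
Implicit Types (x y : nat -> R[i]) (c : R[i]).

Let p0 : 0 < p. Proof. exact: lt_le_trans p1. Qed.

Lemma lp_sum_ge0 x : (0 <= lp_sum p x)%E.
Proof. by rewrite unlock; apply: nneseries_ge0 => k _ _;
  rewrite lee_fin powR_ge0. Qed.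

Lemma normc_ge0 (z : R[i]) : 0 <= normc z.
Proof. by case: z => a b; exact: sqrtr_ge0. Qed.

Lemma lp_sum_le x y : (forall k, normc (x k) <= normc (y k)) ->
  (lp_sum p x <= lp_sum p y)%E.
Proof.
move=> xy; rewrite unlock; apply: lee_nneseries => [k _ _|k _];
  first by rewrite lee_fin powR_ge0.
by rewrite lee_fin ge0_ler_powR ?nnegrE ?normc_ge0 ?(ltW p0)//.
Qed.

Lemma le_poweRVp (a b : \bar R) : (0 <= a)%E -> (a <= b)%E ->
  (a `^ p^-1 <= b `^ p^-1)%E.
Proof.
move=> a0 ab; apply: gt0_ler_poweR; [| | |exact: ab].
- by rewrite invr_ge0 ltW.
- by rewrite in_itv/= leey andbT.
- by rewrite in_itv/= leey andbT (le_trans a0).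
Qed.

Lemma lp_sum_Lnorm x :
  ('N[@counting nat R]_p%:E[EFin \o (@normc R \o x)] = lp_sum p x `^ p^-1)%E.
Proof.
rewrite Lnorm_counting// [lp_sum]unlock; congr (_ `^ _)%E.
by apply: eq_eseriesr => k _; rewrite abse_EFin poweR_EFin ger0_norm ?normc_ge0.
Qed.

Lemma lp_sumD x y :
  (lp_sum p (x + y)%R `^ p^-1 <= lp_sum p x `^ p^-1 + lp_sum p y `^ p^-1)%E.
Proof.
rewrite -!lp_sum_Lnorm.
apply: le_trans (minkowski_EFin (@counting nat R) _ _ p1); [|by []|by []].
rewrite !Lnorm_counting//.
apply: le_poweRVp.
  by rewrite nneseries_ge0// => k *; rewrite lee_fin powR_ge0.
apply: lee_nneseries => [k _ _|k _]; first exact: poweR_ge0.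
rewrite !abse_EFin !poweR_EFin lee_fin ge0_ler_powR ?nnegrE ?(ltW p0)//.
by rewrite !ger0_norm ?addr_ge0 ?normc_ge0//; exact: (le_normcD (x k) (y k)).
Qed.

Lemma lp_sumZ c x : lp_sum p (c *: x) = ((normc c `^ p)%:E * lp_sum p x)%E.
Proof.
rewrite [lp_sum]unlock -nneseriesZl; last by move=> k _;
  rewrite lee_fin powR_ge0.
apply: eq_eseriesr => k _.
by rewrite -EFinM -powRM ?normc_ge0// -normcM.
Qed.

Lemma lp_sum0 : lp_sum p (0 : nat -> R[i]) = 0%E.
Proof. by rewrite unlock; apply: eseries0 => k _ _;
  rewrite normc0 powR0// gt_eqF. Qed.

Lemma lpP x : reflect (lp_sum p x < +oo)%E (x \in lp p1).
Proof. exact: asboolP. Qed.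

Lemma lp_normE x : x \in lp p1 -> (lp_norm p x)%:E = (lp_sum p x `^ p^-1)%E.
Proof.
move=> /lpP x1; rewrite [lp_norm]unlock -poweR_EFin fineK// ge0_fin_numE//.
exact: lp_sum_ge0.
Qed.

Lemma lp_submod_closed : submod_closed (lp p1).
Proof.
split=> [|c x y /lpP xp /lpP yp]; apply/lpP; first by rewrite lp_sum0.
apply: (@lty_poweRy _ _ p^-1); first by rewrite invr_eq0 gt_eqF.
apply: le_lt_trans (lp_sumD _ _) _.
rewrite lte_add_pinfty ?poweR_lty// lp_sumZ lte_mul_pinfty//.
by rewrite lee_fin powR_ge0.
Qed.

HB.instance Definition _ := GRing.isSubmodClosed.Build _ _ (lp p1)
  lp_submod_closed.

Lemma lp_norm_le x y : x \in lp p1 -> y \in lp p1 ->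
  (lp_sum p x <= lp_sum p y)%E -> lp_norm p x <= lp_norm p y.
Proof.
move=> xp yp xy; rewrite -lee_fin (lp_normE xp) (lp_normE yp).
by apply: le_poweRVp xy; exact: lp_sum_ge0.
Qed.

Lemma lp_normD x y : x \in lp p1 -> y \in lp p1 ->
  lp_norm p (x + y) <= lp_norm p x + lp_norm p y.
Proof. by move=> xp yp; rewrite -lee_fin EFinD !lp_normE ?rpredD// lp_sumD. Qed.

Lemma lp_normZ c x : x \in lp p1 -> lp_norm p (c *: x) = normc c * lp_norm p x.
Proof.
move=> xp; apply/EFin_inj;
  rewrite EFinM (lp_normE xp) lp_normE ?rpredZ// => {xp}.
rewrite lp_sumZ poweRM ?lee_fin ?powR_ge0 ?lp_sum_ge0//.
by rewrite poweR_EFin -powRrM mulfV ?gt_eqF// powRr1 ?normc_ge0.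
Qed.

Lemma lp_norm_eq0 x : x \in lp p1 -> lp_norm p x = 0 -> x = 0.
Proof.
move=> xp x0; have := lp_normE xp; rewrite x0 => /esym.
move=> /(poweR_eq0_eq0 (lp_sum_ge0 x)) {}x0.
apply/funext => k; apply: eq0_normc.
have : ((normc (x k) `^ p)%:E <= 0)%E.
  rewrite -x0 [lp_sum]unlock (@nneseriesD1 _ _ k)//; last by move=> j _;
    rewrite lee_fin powR_ge0.
  by rewrite leeDl// nneseries_ge0// => j *; rewrite lee_fin powR_ge0.
rewrite lee_fin => xk0; apply/eqP.
have := xk0; rewrite le_eqVlt ltNge powR_ge0 orbF powR_eq0.
by case/andP.
Qed.

End lp_facts.

Record ell (R : realType) (p : R) (p1 : 1 <= p) := Ell {
  ell_seq :> nat -> R[i];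
  _ : ell_seq \in lp p1
}.

Section ell_normed.
Context {R : realType} (p : R) (p1 : 1 <= p).

HB.instance Definition _ := [isSub for @ell_seq R p p1].
HB.instance Definition _ := [Choice of ell p1 by <:].
HB.instance Definition _ := [SubChoice_isSubLmodule of ell p1 by <:].

Definition ell_norm (x : ell p1) : R[i] := (lp_norm p x)%:C.

Lemma ell_normD x y : ell_norm (x + y) <= ell_norm x + ell_norm y.
Proof. by rewrite -rmorphD/= lecR lp_normD//; exact: valP. Qed.

Lemma ell_normZ c x : ell_norm (c *: x) = `|c| * ell_norm x.
Proof. by rewrite /ell_norm/= lp_normZ ?rmorphM//; exact: valP. Qed.

Lemma ell_norm_eq0 x : ell_norm x = 0 -> x = 0.
Proof.
by move=> /complexI /lp_norm_eq0 x0; apply/val_inj/x0; exact: valP.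
Qed.

HB.instance Definition _ := Lmodule_isNormed.Build R[i] (ell p1)
  ell_normD ell_normZ ell_norm_eq0.

End ell_normed.

Section ell_complete.
Context {R : realType} (p : R) (p1 : 1 <= p).

Let p0 : 0 < p. Proof. exact: lt_le_trans p1. Qed.

Let trunc n (x : nat -> R[i]) : nat -> R[i] :=
  fun k => if (k < n)%N then x k else 0.

Let lp_sum_trunc n x :
  lp_sum p (trunc n x) = (\sum_(0 <= k < n) (normc (x k) `^ p)%:E)%E.
Proof.
rewrite [lp_sum]unlock (nneseries_split 0 n); last by move=> k _;
  rewrite lee_fin powR_ge0.
rewrite add0n [X in (_ + X)%E]eseries0 ?adde0.
  by apply: eq_big_nat => k /andP[_ kn]; rewrite /trunc kn.
by move=> k nk _; rewrite /trunc ltnNge nk [normc _]normc0 powR0 ?gt_eqF.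
Qed.

Let trunc_lp n x : trunc n x \in lp p1.
Proof. by apply/lpP; rewrite lp_sum_trunc sumEFin ltry. Qed.

Let lp_norm_trunc_le n x : x \in lp p1 -> lp_norm p (trunc n x) <= lp_norm p x.
Proof.
move=> xp; apply: (lp_norm_le (p1 := p1)) => //; apply: lp_sum_le => // k.
by rewrite /trunc; case: ifP => // _; rewrite normc0 normc_ge0.
Qed.

Let lp_sum_bound x (e : R) : 0 <= e ->
  (forall n, lp_norm p (trunc n x) <= e) -> (lp_sum p x <= (e `^ p)%:E)%E.
Proof.
move=> e0 xe; rewrite [lp_sum]unlock; apply: lime_le.
  by apply: is_cvg_nneseries => k _ _; rewrite lee_fin powR_ge0.
apply: nearW => n; rewrite -lp_sum_trunc.
have /lpP tp := trunc_lp n x.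
rewrite -(@fineK _ (lp_sum p (trunc n x))); last first.
  by rewrite ge0_fin_numE// lp_sum_ge0.
rewrite lee_fin; have := xe n; rewrite [lp_norm]unlock => le_e.
rewrite -[leLHS]powRr1 ?fine_ge0 ?lp_sum_ge0//.
rewrite -(mulVf (lt0r_neq0 p0)) powRrM.
by rewrite ge0_ler_powR ?nnegrE ?powR_ge0 ?(ltW p0).
Qed.

Let lp_norm_bound x (e : R) : 0 <= e ->
  (forall n, lp_norm p (trunc n x) <= e) -> x \in lp p1 /\ lp_norm p x <= e.
Proof.
move=> e0 xe; have xs := lp_sum_bound e0 xe.
have xp : x \in lp p1 by apply/lpP/(le_lt_trans xs); rewrite ltry.
split; first exact: xp.
rewrite -lee_fin (lp_normE xp).
rewrite -[e](powRr1 e0) -(mulfV (lt0r_neq0 p0)) powRrM -poweR_EFin.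
by apply: (le_poweRVp p1) xs; exact: lp_sum_ge0.
Qed.

Let le_normc_lp x k : x \in lp p1 -> normc (x k) <= lp_norm p x.
Proof.
move=> xp; rewrite -lee_fin (lp_normE xp) => {xp}.
rewrite -[normc _](powRr1 (normc_ge0 _)) -(mulfV (lt0r_neq0 p0)) powRrM
  -poweR_EFin.
apply: (le_poweRVp p1); first by rewrite lee_fin powR_ge0.
rewrite [lp_sum]unlock (@nneseriesD1 _ _ k)//; last by move=> j _;
  rewrite lee_fin powR_ge0.
by rewrite leeDl// nneseries_ge0// => j *; rewrite lee_fin powR_ge0.
Qed.

Let normc_real (a : R) : normc a%:C = `|a|.
Proof. by rewrite /= expr0n addr0 sqrtr_sqr. Qed.

Let normc_imag (a : R) : normc (0 +i* a) = `|a|.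
Proof. by rewrite /= expr0n add0r sqrtr_sqr. Qed.

Let normc_ReIm (z : R[i]) : normc z <= `|complex.Re z| + `|complex.Im z|.
Proof.
case: z => a b; have := le_normcD a%:C (0 +i* b).
by rewrite normc_real normc_imag;
  rewrite -[a%:C + _]/((a + 0) +i* (0 + b)) addr0 add0r.
Qed.

Let Re_le_normc (z : R[i]) : `|complex.Re z| <= normc z.
Proof. by case: z => a b /=; rewrite -sqrtr_sqr ler_wsqrtr// lerDl sqr_ge0. Qed.

Let Im_le_normc (z : R[i]) : `|complex.Im z| <= normc z.
Proof. by case: z => a b /=; rewrite -sqrtr_sqr ler_wsqrtr// lerDr sqr_ge0. Qed.

Let ball_ellE (x y : ell p1) (e : R) :
  ball x e%:C y <-> lp_norm p (x - y : ell p1) < e.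
Proof. by rewrite -ball_normE /ball_/= -[`|_|]/((_ _)%:C) ltcR. Qed.

Section limit.
Context (F : set_system (ell p1)) (FF : ProperFilter F) (cF : cauchy F).

Let cF_ball (e : R) : 0 < e -> exists y, F (ball y e%:C).
Proof. by move=> e0; apply: (cauchyP _).1 => //; rewrite ltcR. Qed.

Let coord_cvg (h : R[i] -> R) k :
  {morph h : a b / a - b} -> (forall z, `|h z| <= normc z) ->
  cvg ((fun x : ell p1 => h (x k)) @ F).
Proof.
move=> hB hle; apply: cauchy_cvg; apply/cauchyP => e e0.
have [y Fy] := cF_ball e0; exists (h (y k)).
suff : F [set x : ell p1 | ball (h (y k)) e (h (x k))] by [].
apply: filterS Fy => x /(ball_ellE _ _ _).1 xy.
rewrite -ball_normE /ball_/= -hB.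
apply: le_lt_trans xy; apply: le_trans (hle _) _.
exact: (le_normc_lp k (valP (y - x))).
Qed.

Let z : nat -> R[i] := fun k =>
  lim ((fun x : ell p1 => complex.Re (x k)) @ F) +i*
  lim ((fun x : ell p1 => complex.Im (x k)) @ F).

Let near_z k (d : R) : 0 < d -> \forall x \near F, normc ((x : ell p1) k - z k)
  <= d.
Proof.
move=> d0; have d20 : 0 < d / 2 by rewrite divr_gt0.
have ReB : {morph (@complex.Re R) : a b / a - b} by move=> [? ?] [? ?].
have ImB : {morph (@complex.Im R) : a b / a - b} by move=> [? ?] [? ?].
have /cvgrPdist_le/(_ _ d20) cr := coord_cvg (k := k) ReB Re_le_normc.
have /cvgrPdist_le/(_ _ d20) ci := coord_cvg (k := k) ImB Im_le_normc.
near=> x.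
apply: le_trans (normc_ReIm _) _.
rewrite ReB ImB [leRHS]splitr lerD// distrC; by near: x.
Unshelve. all: by end_near. Qed.

Let near_trunc n (d : R) : 0 < d ->
  \forall x \near F, forall k, (k < n)%N -> normc ((x : ell p1) k - z k) <= d.
Proof.
move=> d0; elim: n => [|n IH]; first exact: nearW.
have zn := near_z n d0; near=> x => k.
rewrite ltnS leq_eqVlt => /predU1P[->|]; first by near: x.
by move: k; near: x.
Unshelve. all: by end_near. Qed.

Let dist_z (A : set (ell p1)) (e : R) (x : ell p1) : 0 <= e -> F A ->
  (forall y, A y -> lp_norm p (x - y : ell p1) <= e) ->
  (x : nat -> R[i]) - z \in lp p1 /\ lp_norm p ((x : nat -> R[i]) - z) <= e.
Proof.
move=> e0 FA xA; apply: lp_norm_bound => // n.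
apply/ler_addgt0Pr => d d0.
pose C := lp_norm p (trunc n (fun=> 1)).
have C0 : 0 <= C by rewrite /C [lp_norm]unlock powR_ge0.
have dC : 0 < d / (C + 1) by rewrite divr_gt0// ltr_wpDl.
near F => y.
have Ay : A y by near: y.
rewrite (_ : trunc n _ = trunc n (x - y : ell p1) +
                         trunc n ((y : nat -> R[i]) - z)); last first.
  apply/funext => k; rewrite /trunc -[RHS]/(_ + _) /=; case: ifP => _;
    last by rewrite addr0.
  by rewrite -[LHS]/(x k - z k) -[RHS]/((x k - y k) + (y k - z k)); ring.
apply: le_trans (lp_normD (trunc_lp _ _) (trunc_lp _ _)) _.
apply: lerD.
  by apply: le_trans (lp_norm_trunc_le _ (valP (x - y))) _; exact: xA.
apply: (@le_trans _ _ (lp_norm p ((d / (C + 1))%:C *: trunc n (fun=> 1)))).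
  apply: (lp_norm_le (p1 := p1)) => //; first by rewrite rpredZ.
  apply: lp_sum_le => // k;
    rewrite -[X in _ <= normc X]/(_ * trunc n _ k) normcM normc_real.
  rewrite gtr0_norm// /trunc; case: ifP => kn; last by rewrite normc0 mulr0.
  rewrite normc1 mulr1; move: k kn; near: y; exact: near_trunc.
rewrite (lp_normZ (p1 := p1))// normc_real gtr0_norm// mulrAC ler_pdivrMr
  ?ltr_wpDl//.
by rewrite ler_wpM2l ?(ltW d0)// lerDl.
Unshelve. all: by end_near. Qed.

Let dist_ball (e : R) (y x x' : ell p1) : ball y e%:C x -> ball y e%:C x' ->
  lp_norm p (x - x' : ell p1) <= e + e.
Proof.
move=> /ball_sym/(ball_ellE _ _ _).1 yx /(ball_ellE _ _ _).1 yx'.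
rewrite (_ : x - x' = (x - y) + (y - x')); last by rewrite addrA subrK.
apply: le_trans (lp_normD (valP (x - y)) (valP (y - x'))) _.
by rewrite lerD// ltW.
Qed.

Let z_lp : z \in lp p1.
Proof.
have [y Fy] := cF_ball ltr01; have [x yx] := filter_ex Fy.
have [xz _] := dist_z (ltW (addr_gt0 ltr01 ltr01)) Fy (fun x' => dist_ball yx
  (x' := x')).
rewrite -[z](subKr (x : nat -> R[i])) rpredB//; exact: valP.
Qed.

Lemma ell_cvg : cvg F.
Proof.
apply/cvg_ex; exists (Ell z_lp); apply/cvgrPdist_le => e e0.
have eE : e = (complex.Re e)%:C by rewrite RRe_real// gtr0_real.
have Re0 : 0 < complex.Re e by rewrite -ltcR -eE.
have e20 : 0 < complex.Re e / 2 by rewrite divr_gt0.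
have [y Fy] := cF_ball e20; near=> x.
have yx : ball y (complex.Re e / 2)%:C x by near: x.
have [_ xz] := dist_z (ltW (addr_gt0 e20 e20)) Fy (fun x' => dist_ball yx (x'
  := x')).
by rewrite distrC eE -[`|_|]/((_ _)%:C) lecR [leRHS]splitr.
Unshelve. all: by end_near. Qed.

End limit.

HB.instance Definition _ := Uniform_isComplete.Build (ell p1) ell_cvg.

End ell_complete.

Definition tribandseq (R : realType) (s r : R[i]) (x : nat -> R[i]) :
    nat -> R[i] := fun k =>
  s * (if k is k'.+1 then x k' else 0) + r * x k + s * x k.+1.

Section triband.
Context {R : realType} (p : R) (p1 : 1 <= p).

Definition rshift (x : nat -> R[i]) : nat -> R[i] :=
  fun k => if k is k'.+1 then x k' else 0.

Definition lshift (x : nat -> R[i]) : nat -> R[i] := fun k => x k.+1.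

Lemma tribandseqE s r x :
  tribandseq s r x = s *: rshift x + r *: x + s *: lshift x.
Proof. by []. Qed.

Let p0 : 0 < p. Proof. exact: lt_le_trans p1. Qed.

Lemma lp_sum_rshift x : lp_sum p (rshift x) = lp_sum p x.
Proof.
rewrite [lp_sum]unlock nneseries_recl//; last by move=> k _;
  rewrite lee_fin powR_ge0.
rewrite [normc _]normc0 powR0 ?gt_eqF// add0e -(@nneseries_addn _ _ 1)//.
  by apply: eq_eseriesr => k _; rewrite addn1.
by move=> k; rewrite lee_fin powR_ge0.
Qed.

Lemma lp_sum_lshift x : (lp_sum p (lshift x) <= lp_sum p x)%E.
Proof.
rewrite [lp_sum]unlock [leRHS]nneseries_recl//; last by move=> k _;
  rewrite lee_fin powR_ge0.
rewrite -(@nneseries_addn _ _ 1)//; last by move=> k; rewrite lee_fin powR_ge0.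
rewrite [leLHS](_ : _ = \sum_(0 <= k <oo) (normc (x (k + 1)%N) `^ p)%:E)%E.
  by rewrite leeDr// lee_fin powR_ge0.
by apply: eq_eseriesr => k _; rewrite addn1.
Qed.

Lemma rshift_lp x : x \in lp p1 -> rshift x \in lp p1.
Proof. by move=> /lpP xp; apply/lpP; rewrite lp_sum_rshift. Qed.

Lemma lshift_lp x : x \in lp p1 -> lshift x \in lp p1.
Proof. by move=> /lpP xp; apply/lpP/(le_lt_trans (lp_sum_lshift x)). Qed.

Lemma tribandseq_lp s r (x : ell p1) : tribandseq s r x \in lp p1.
Proof.
have xp : (x : nat -> R[i]) \in lp p1 by exact: valP.
by rewrite tribandseqE !rpredD ?rpredZ ?rshift_lp ?lshift_lp.
Qed.

(* The operator U(s, r, s) on l_p. *)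
Definition triband s r (x : ell p1) : ell p1 := Ell (tribandseq_lp s r x).

Lemma triband_linear s r : linear (triband s r).
Proof.
move=> a x y; apply/val_inj/funext => -[|k] /=.
- rewrite -[LHS]/(s * 0 + r * (a * x 0 + y 0) + s * (a * x 1 + y 1)).
  rewrite -[RHS]/(a * (s * 0 + r * x 0 + s * x 1) + (s * 0 + r * y 0 + s * y
    1)).
  by ring.
- rewrite -[LHS]/(s * (a * x k + y k) + r * (a * x k.+1 + y k.+1) + s * (a * x
    k.+2 + y k.+2)).
  rewrite -[RHS]/(a * (s * x k + r * x k.+1 + s * x k.+2) + (s * y k + r * y
    k.+1 + s * y k.+2)).
  by ring.
Qed.

HB.instance Definition _ s r :=
  GRing.isLinear.Build _ _ _ _ (triband s r) (triband_linear s r).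

Lemma triband_bounded s r (x : ell p1) :
  `|triband s r x| <= (`|s| + `|r| + `|s|) * `|x|.
Proof.
have xp : (x : nat -> R[i]) \in lp p1 by exact: valP.
rewrite -[leLHS]/((_ _)%:C) -[`|x|]/((_ _)%:C) /=.
rewrite -[`|s|]/(normc s)%:C -[`|r|]/(normc r)%:C -!rmorphD -rmorphM lecR.
rewrite tribandseqE.
rewrite (le_trans (lp_normD (p1 := p1) _ _)) ?rpredD ?rpredZ ?rshift_lp
  ?lshift_lp//.
rewrite mulrDl lerD//.
  rewrite (le_trans (lp_normD (p1 := p1) _ _)) ?rpredD ?rpredZ ?rshift_lp
    ?lshift_lp//.
  rewrite mulrDl lerD// (lp_normZ (p1 := p1)) ?rshift_lp//.
  by rewrite [lp_norm]unlock lp_sum_rshift.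
rewrite (lp_normZ (p1 := p1)) ?lshift_lp// ler_wpM2l ?normc_ge0//.
by apply: (lp_norm_le (p1 := p1)) => //;
  [exact: lshift_lp|exact: lp_sum_lshift].
Qed.

Lemma triband_continuous s r : continuous (triband s r).
Proof.
apply/linear_bounded_continuous/bounded_funP => M.
exists ((`|s| + `|r| + `|s|) * M) => x xM.
apply: le_trans (triband_bounded s r x) _.
by rewrite ler_wpM2l// !addr_ge0.
Qed.

End triband.

Arguments triband {R p} p1 s r x.

Section spectrum.
Context {R : realType} {X : completeNormedModType R[i]} (T : {linear X -> X}).

(* The second clause says that the inverse of Tl, which sends y = Tl x in
   range Tl to x, is bounded on its domain. *)
Definition regular_value (l : R[i]) :=
  let Tl := fun x => T x - l *: x in
  [/\ injective Tl,
      exists2 M : R[i], 0 <= M & forall x y, Tl x = y -> `|x| <= M * `|y|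
    & dense (range Tl)].

Definition spectrum : set R[i] := [set l | ~ regular_value l].

End spectrum.

(* Main.v *)
(* Let S and L be the right and left shifts, so that L S = 1. Off the segment,
   the Joukowski equation z + 1/z = (l - r)/s has a root with |z| < 1 and
   U(s, r, s) - l = a (1 - z L) (1 - z S) for some a != 0. As S and L are
   contractions, each factor is bounded below by 1 - |z| and, by partial sums of
   the Neumann series, has dense range; hence l is regular. On the segment
   l = r + s (z + 1/z) with |z| = 1, and the truncations to {0, ..., n} of the
   sequence (z^k) have norm (n + 1)^(1/p) whereas U(s, r, s) - l maps them into
   the ball of radius 3 |s|: the inverse is unbounded. *)
Require Import Defs.
From HB Require Import structures.
From mathcomp Require Import all_boot all_order all_algebra.
From mathcomp Require Import complex.
From mathcomp Require Import all_classical all_reals all_analysis.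
From mathcomp Require Import ring.
Import Order.TTheory GRing.Theory Num.Theory.
Import numFieldNormedType.Exports.

Local Open Scope classical_set_scope.
Local Open Scope complex_scope.
Local Open Scope ring_scope.

(** * Perturbations [x - z *: A x] of the identity by a contraction [A] *)

Section contraction.
Context {R : realType} {V : normedModType R[i]}.
Implicit Types (A : {linear V -> V}) (x y : V) (z e : R[i]).

Lemma scale_expr_small z x e : `|z| < 1 -> 0 < e ->
  exists n, `|z ^+ n *: x| < e.
Proof.
move=> z1 e0.
(* The order on [R[i]] is partial; nonnegative elements are real, so the claim reduces to a real
   geometric sequence. *)
have realE (a : R[i]) : 0 <= a -> a = (complex.Re a)%:C.
  by move=> a0; rewrite RRe_real// ger0_real.
set q := complex.Re `|z|; set c := complex.Re `|x|; set d := complex.Re e.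
have d0 : 0 < d by rewrite -ltcR -realE ?ltW.
have q0 : 0 <= q by rewrite -lecR -realE//; exact: normr_ge0.
have q1 : `|q| < 1 by rewrite ger0_norm// -ltcR -realE.
have /cvgrPdist_lt/(_ _ d0) [n _ /(_ n (leqnn n))] := cvg_geometric c q1.
rewrite sub0r normrN => cq; exists n.
rewrite normrZ normrX (realE _ (normr_ge0 z)) (realE _ (normr_ge0 x)) -/q -/c.
rewrite (realE _ (ltW e0)) -/d -rmorphXn -rmorphM ltcR mulrC.
exact: le_lt_trans (ler_norm _) cq.
Qed.

Lemma dense_approx (f : V -> V) :
  (forall y e, 0 < e -> exists x, `|y - f x| < e) -> dense (range f).
Proof.
move=> fe O [y Oy] oO.
have /nbhs_ballP[e /= e0 yO] := open_nbhs_nbhs (conj oO Oy).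
have [x yx] := fe y e e0; exists (f x); split; last by exists x.
by apply: yO; rewrite -ball_normE.
Qed.

(** Reverse triangle inequality. For [|z| < 1] the constant is positive, which gives injectivity and
    a bounded inverse at once. *)
Lemma contraction_lower_bound A z : (forall x, `|A x| <= `|x|) ->
  forall x, (1 - `|z|) * `|x| <= `|x - z *: A x|.
Proof.
move=> A1 x; rewrite mulrBl mul1r lerBlDr.
rewrite -{1}[x](subrK (z *: A x)) (le_trans (ler_normD _ _))//.
by rewrite lerD2l normrZ ler_wpM2l.
Qed.

Lemma contraction_upper_bound A z : `|z| <= 1 -> (forall x, `|A x| <= `|x|) ->
  forall x, `|x - z *: A x| <= 2 * `|x|.
Proof.
move=> z1 A1 x; rewrite mulr_natl mulr2n (le_trans (ler_normB _ _))// lerD2l.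
by rewrite normrZ (le_trans (ler_wpM2l _ (A1 x)))// ler_piMl.
Qed.

(* The approximate preimage is a partial sum of the Neumann series of y. *)
Lemma contraction_approx A z : `|z| < 1 -> (forall x, `|A x| <= `|x|) ->
  forall y e, 0 < e -> exists x, `|y - (x - z *: A x)| < e.
Proof.
move=> z1 A1 y e e0.
(* The sum telescopes: after [n] terms the residual is a single term, of norm at most
   [|z| ^+ n * |y|]. *)
have neumann n : exists x, y - (x - z *: A x) = z ^+ n *: iter n A y.
  elim: n => [|n [x xE]].
    by exists 0; rewrite linear0 scaler0 !subr0 scale1r.
  exists (x + z ^+ n *: iter n A y).
  rewrite (linearD A) (linearZ_LR A) scalerDr scalerA -exprS.
  rewrite [- (z *: _ + _)]opprD addrACA opprD.
  by rewrite addrA xE opprB addrC subrK.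
have [n zn] := scale_expr_small _ y _ z1 e0.
have [x xE] := neumann n; exists x; rewrite xE.
apply: le_lt_trans zn; rewrite !normrZ ler_wpM2l//.
by elim: n {xE} => //= n IH; exact: le_trans (A1 _) IH.
Qed.

End contraction.

(** * Products of two such factors *)

Section contraction_product.
Context {R : realType} {X : completeNormedModType R[i]}.
Context (T A B : {linear X -> X}) (l a z : R[i]).
Context (A1 : forall x, `|A x| <= `|x|) (B1 : forall x, `|B x| <= `|x|).
Context (a0 : a != 0) (z1 : `|z| < 1).
Context (TE : forall x, T x - l *: x =
  a *: (x - z *: B x - z *: A (x - z *: B x))).

(** Lower bounds multiply, and density of the ranges passes to the product because the outer factor
    is bounded. *)
Lemma contraction_product_regular : regular_value T l.
Proof.
have z1' : 0 < 1 - `|z| by rewrite subr_gt0.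
have Tge x : `|a| * (1 - `|z|) ^+ 2 * `|x| <= `|T x - l *: x|.
  rewrite TE normrZ -mulrA ler_wpM2l// expr2 -mulrA.
  apply: le_trans (contraction_lower_bound _ _ A1 _); rewrite ler_pM2l//.
  exact: contraction_lower_bound.
have c0 : 0 < `|a| * (1 - `|z|) ^+ 2 by rewrite mulr_gt0 ?normr_gt0 ?exprn_gt0.
split.
- move=> x y Txy; apply/eqP; rewrite -subr_eq0 -normr_le0.
  rewrite -(pmulr_rle0 _ c0) (le_trans (Tge _))// (linearB T) scalerBr.
  by rewrite [- (_ - _)]opprD addrACA -[- T y - _]opprD Txy subrr normr0.
- exists (`|a| * (1 - `|z|) ^+ 2)^-1; first by rewrite invr_ge0 ltW.
  by move=> x y <-; rewrite ler_pdivlMl.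
- apply: dense_approx => y e e0.
  have a0' : 0 < `|a| by rewrite normr_gt0.
  (* Error budget, after dividing by [a]: one half for the outer factor, the other for the inner
     one, whose error the outer factor can double; hence the extra [/ 2] in [e'0']. *)
  have e'0 : 0 < e / `|a| / 2 by rewrite !divr_gt0.
  have [u yu] := contraction_approx A z z1 A1 (a^-1 *: y) _ e'0.
  have e'0' : 0 < e / `|a| / 2 / 2 by rewrite !divr_gt0.
  have [x ux] := contraction_approx B z z1 B1 u _ e'0'.
  exists x; rewrite TE; move: (x - z *: B x) ux => v uv.
  rewrite -[y](scalerKV a0) -scalerBr normrZ mulrC -ltr_pdivlMr//.
  rewrite -(subrK (u - z *: A u) (a^-1 *: y)) -addrA.
  rewrite (le_lt_trans (ler_normD _ _))// [ltRHS]splitr ltrD//.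
  have -> : u - z *: A u - (v - z *: A v) = (u - v) - z *: A (u - v).
    by rewrite (linearB A) scalerBr [- (v - _)]opprD addrACA -opprD.
  rewrite (le_lt_trans (contraction_upper_bound _ _ (ltW z1) A1 _))//.
  by rewrite mulrC -ltr_pdivlMr.
Qed.

End contraction_product.

(** * The Joukowski equation and the coefficients of the factorisation *)

Section joukowski.
Context {R : realType}.
Implicit Types (z w mu r s l : R[i]).

(* The two roots have product 1; if neither lies in the open disc, both are on
   the unit circle and conjugate, so that mu = 2 Re z. *)
Lemma joukowski_disc mu :
  (forall t, t \in `[0, 2 * pi]%R -> mu != 2 * (cos t : R)%:C) ->
  exists2 z, `|z| < 1 & z ^+ 2 - mu * z + 1 = 0.
Proof.
move=> muN; pose d := sqrtc (mu ^+ 2 - 4).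
have d2 : d ^+ 2 = mu ^+ 2 - 4 by rewrite sqr_sqrtc.
pose z := (mu + d) / 2; pose w := (mu - d) / 2.
have two0 : (2 : R[i]) != 0 by rewrite pnatr_eq0.
have zDw : z + w = mu by rewrite /z /w; field.
have zw : z * w = 1.
  have -> : z * w = (mu ^+ 2 - d ^+ 2) / 4 by rewrite /z /w; field.
  by rewrite d2; field.
have [z1|z1] := real_ltP (normr_real z) (real1 _).
  by exists z => //; rewrite -zDw -zw; ring.
have [w1|w1] := real_ltP (normr_real w) (real1 _).
  by exists w => //; rewrite -zDw -zw; ring.
have zw1 : `|z| * `|w| = 1 by rewrite -normrM zw normr1.
have z_eq1 : `|z| = 1.
  by apply/le_anti; rewrite z1 andbT -zw1 ler_peMr.
have wE : w = z^*%C.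
  have z0 : z != 0 by rewrite -normr_gt0 z_eq1.
  by apply: (mulfI z0); rewrite zw -sqr_normc z_eq1 expr1n.
have Rez : -1 <= complex.Re z <= 1.
  rewrite -ler_norml -lecR; apply: le_trans (_ : `|z| <= 1).
    by case: (z) => x y; rewrite lecR -sqrtr_sqr ler_wsqrtr// lerDl sqr_ge0.
  by rewrite z_eq1.
(* The angle contradicting [muN] is the [acos] of the real part, which lies in [0, pi]. *)
have acosI : acos (complex.Re z) \in `[0, 2 * pi]%R.
  rewrite in_itv/= acos_ge0//= (le_trans (acos_lepi Rez))//.
  by rewrite ler_peMl ?pi_ge0// ler1n.
have := muN _ acosI.
by rewrite acosK ?in_itv//= -addcJ -wE zDw eqxx.
Qed.

(** Compares coefficients in U - l = a (1 + z^2) - a z (L + S). For s != 0, eliminating a leaves z +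
    1/z = (l - r)/s. *)
Lemma triband_symbol_factor r s l :
  (forall t, t \in `[0, 2 * pi]%R -> l != r + 2 * s * (cos t : R)%:C) ->
  exists a z, [/\ a != 0, `|z| < 1, s = - (a * z) & r = l + a * (1 + z ^+ 2)].
Proof.
move=> lN; have [s0|s0] := eqVneq s 0.
  (* Here the segment is the point [r]; any angle, say 0, yields [l != r], and [z = 0] works. *)
  have pi0 : 0 \in `[0, 2 * pi : R]%R.
    by rewrite in_itv/= lexx mulr_ge0 ?pi_ge0.
  exists (r - l), 0; split; rewrite ?normr0 ?ltr01//.
  - by have := lN 0 pi0; rewrite s0 mulr0 mul0r addr0 eq_sym subr_eq0.
  - by rewrite mulr0 oppr0.
  - by rewrite expr0n addr0 mulr1 addrC subrK.
have [|z z1 zE] := joukowski_disc ((l - r) / s).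
  move=> t tI; apply: contra (lN t tI) => /eqP lE; apply/eqP.
  by rewrite mulrAC -lE divfK// addrC subrK.
have z0 : z != 0.
  by apply: contra_eq_neq zE => ->; rewrite expr0n mulr0 subr0 add0r oner_neq0.
exists (- s / z), z; split=> //.
- by rewrite mulf_neq0 ?oppr_eq0 ?invr_eq0.
- by rewrite divfK// opprK.
- have -> : 1 + z ^+ 2 = (l - r) / s * z.
    by apply/eqP; rewrite -subr_eq0 -zE; apply/eqP; ring.
  by field; rewrite s0.
Qed.

End joukowski.

(** * The shifts on l_p and the operator factorisation *)

Section shifts.
Context {R : realType} {p : R} {p1 : 1 <= p}.
Implicit Types x : ell p1.

Definition ell_rshift x : ell p1 := Ell (rshift_lp (valP x)).
Definition ell_lshift x : ell p1 := Ell (lshift_lp (valP x)).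

Lemma ell_rshift_linear : linear ell_rshift.
Proof.
move=> a x y; apply/val_inj/funext => -[|k] //=.
by rewrite -[RHS]/(a * 0 + 0) mulr0 addr0.
Qed.

Lemma ell_lshift_linear : linear ell_lshift.
Proof. by move=> a x y; apply/val_inj/funext. Qed.

HB.instance Definition _ :=
  GRing.isLinear.Build _ _ _ _ ell_rshift ell_rshift_linear.
HB.instance Definition _ :=
  GRing.isLinear.Build _ _ _ _ ell_lshift ell_lshift_linear.

Lemma ell_rshift_contraction x : `|ell_rshift x| <= `|x|.
Proof.
rewrite -[leLHS]/((_ _)%:C) -[`|x|]/((_ _)%:C) lecR.
apply: (lp_norm_le (p1 := p1)); [exact: valP|exact: valP|].
by rewrite lp_sum_rshift.
Qed.

Lemma ell_lshift_contraction x : `|ell_lshift x| <= `|x|.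
Proof.
rewrite -[leLHS]/((_ _)%:C) -[`|x|]/((_ _)%:C) lecR.
apply: (lp_norm_le (p1 := p1)); [exact: valP|exact: valP|].
exact: lp_sum_lshift.
Qed.

(** The left shift must be the outer factor: L S = 1 makes the diagonal constant, whereas S L would
    spoil the entry at index 0. *)
Lemma triband_factor a z l x :
  let y := x - z *: ell_rshift x in
  triband p1 (- (a * z)) (l + a * (1 + z ^+ 2)) x - l *: x
    = a *: (y - z *: ell_lshift y).
Proof.
apply/val_inj/funext => -[|k] /=.
- rewrite -[LHS]/(- (a * z) * 0 + (l + a * (1 + z ^+ 2)) * x 0%N +
    - (a * z) * x 1%N - l * x 0%N).
  rewrite -[RHS]/(a * ((x 0%N - z * 0) - z * (x 1%N - z * x 0%N))).
  by ring.
- rewrite -[LHS]/(- (a * z) * x k + (l + a * (1 + z ^+ 2)) * x k.+1 +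
    - (a * z) * x k.+2 - l * x k.+1).
  rewrite -[RHS]/(a * ((x k.+1 - z * x k) - z * (x k.+2 - z * x k.+1))).
  by ring.
Qed.

End shifts.

(** * Approximate eigenvectors on the segment *)

Section approximate_eigenvectors.
Context {R : realType} {p : R} {p1 : 1 <= p}.
Implicit Types (x : ell p1) (z : R[i]).

Let p0 : 0 < p. Proof. exact: lt_le_trans p1. Qed.

Definition deltaseq k : nat -> R[i] := fun j => (j == k)%:R.

Lemma lp_sum_deltaseq k : lp_sum p (deltaseq k) = 1%E.
Proof.
rewrite [lp_sum]unlock (@nneseriesD1 _ _ k)//; last first.
  by move=> j _; rewrite lee_fin powR_ge0.
rewrite {1}/deltaseq eqxx Normc.normc1 powR1 eseries0 ?adde0// => j _ jk.
by rewrite /deltaseq (negbTE jk) Normc.normc0 powR0// gt_eqF.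
Qed.

Lemma deltaseq_lp k : deltaseq k \in lp p1.
Proof. by apply/lpP; rewrite lp_sum_deltaseq ltry. Qed.

Definition delta k : ell p1 := Ell (deltaseq_lp k).

Lemma norm_delta k : `|delta k| = 1.
Proof.
by rewrite -[LHS]/((_ _)%:C) [lp_norm]unlock lp_sum_deltaseq powR1.
Qed.

(** As a finite combination of unit vectors it lies in l_p automatically, and the operator acts on
    it term by term. *)
Definition geometric_ell z n : ell p1 := \sum_(k < n.+1) z ^+ k *: delta k.

Lemma geometric_ellE z n j :
  geometric_ell z n j = if (j <= n)%N then z ^+ j else 0.
Proof.
rewrite /geometric_ell; elim: n => [|n IH].
  rewrite big_ord1 -[LHS]/(1 * deltaseq 0 j) mul1r /deltaseq leqn0.
  by case: eqP => [->|].
rewrite big_ord_recr -[LHS]/(ell_seq _ j + z ^+ n.+1 * deltaseq n.+1 j) IH.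
rewrite /deltaseq [in RHS]leq_eqVlt ltnS.
by case: eqP => [->|_] /=; rewrite ?ltnn ?add0r ?mulr1// mulr0 addr0.
Qed.

Lemma lp_normK x : (lp_norm p x `^ p)%:E = lp_sum p x.
Proof.
have /lpP xp := valP x.
rewrite [lp_norm]unlock -powRrM mulVf ?gt_eqF// powRr1 ?fine_ge0 ?lp_sum_ge0//.
by rewrite fineK// ge0_fin_numE// lp_sum_ge0.
Qed.

Lemma lp_norm_geometric z n : `|z| = 1 ->
  n.+1%:R <= lp_norm p (geometric_ell z n) `^ p.
Proof.
move=> z1; rewrite -lee_fin lp_normK [lp_sum]unlock.
apply: le_trans (nneseries_lim_ge n.+1 _); last first.
  by move=> k _ _; rewrite lee_fin powR_ge0.
rewrite sumEFin lee_fin.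
rewrite (eq_big_nat _ _ (F2 := fun=> 1)) => [|k /andP[_ kn]].
  by rewrite big_const_nat subn0 iter_addr_0.
have -> : Normc.normc (geometric_ell z n k) = 1.
  rewrite geometric_ellE -ltnS kn; apply: complexI.
  by rewrite -[LHS]/`|z ^+ k| normrX z1 expr1n.
by rewrite powR1.
Qed.

(** Index 0 has no left neighbour; the missing entry causes the error term [w *: delta 0] in
    [triband_geometric]. *)
Lemma triband_delta0 s r :
  triband p1 s r (delta 0) = s *: delta 1 + r *: delta 0.
Proof.
apply/val_inj/funext => -[|j].
- rewrite -[LHS]/(s * 0 + r * deltaseq 0 0 + s * deltaseq 0 1).
  by rewrite -[RHS]/(s * deltaseq 1 0 + r * deltaseq 0 0) /deltaseq /=; ring.
- rewrite -[LHS]/(s * deltaseq 0 j + r * deltaseq 0 j.+1 + s * deltaseq 0 j.+2).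
  rewrite -[RHS]/(s * deltaseq 1 j.+1 + r * deltaseq 0 j.+1) /deltaseq /=.
  by rewrite eqSS; ring.
Qed.

Lemma triband_deltaS s r k :
  triband p1 s r (delta k.+1)
    = s *: delta k.+2 + r *: delta k.+1 + s *: delta k.
Proof.
apply/val_inj/funext => -[|j].
- rewrite -[LHS]/(s * 0 + r * deltaseq k.+1 0 + s * deltaseq k.+1 1).
  rewrite -[RHS]/(s * deltaseq k.+2 0 + r * deltaseq k.+1 0 + s * deltaseq k 0).
  by rewrite /deltaseq eqSS /=; ring.
- rewrite -[LHS]/(s * deltaseq k.+1 j + r * deltaseq k.+1 j.+1
    + s * deltaseq k.+1 j.+2).
  rewrite -[RHS]/(s * deltaseq k.+2 j.+1 + r * deltaseq k.+1 j.+1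
    + s * deltaseq k j.+1).
  by rewrite /deltaseq !eqSS.
Qed.

(* (z^k) is a formal eigenvector away from the boundary, so that truncating it
   leaves an error supported on {0, n, n + 1}. *)
Lemma triband_geometric s r z w n : z * w = 1 ->
  triband p1 s r (geometric_ell z n) - (r + s * (z + w)) *: geometric_ell z n
    = s *: (z ^+ n *: delta n.+1 - w *: delta 0 - z ^+ n.+1 *: delta n).
Proof.
move=> zw; rewrite /geometric_ell; elim: n => [|n IH].
  rewrite big_ord1 expr0 !scale1r triband_delta0.
  apply/val_inj/funext => j.
  rewrite -[LHS]/(s * deltaseq 1 j + r * deltaseq 0 j
    - (r + s * (z + w)) * deltaseq 0 j).
  rewrite -[RHS]/(s * (deltaseq 1 j - w * deltaseq 0 j - z * deltaseq 0 j)).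
  by ring.
rewrite big_ord_recr /= (linearD (triband p1 s r)) scalerDr opprD addrACA IH.
rewrite (linearZ_LR (triband p1 s r)) /= triband_deltaS.
apply/val_inj/funext => j.
rewrite -[LHS]/(s * (z ^+ n * deltaseq n.+1 j - w * deltaseq 0 j
    - z ^+ n.+1 * deltaseq n j)
  + (z ^+ n.+1 * (s * deltaseq n.+2 j + r * deltaseq n.+1 j + s * deltaseq n j)
    - (r + s * (z + w)) * (z ^+ n.+1 * deltaseq n.+1 j))).
rewrite -[RHS]/(s * (z ^+ n.+1 * deltaseq n.+2 j - w * deltaseq 0 j
    - z ^+ n.+2 * deltaseq n.+1 j)).
(* This uses up [z * w = 1]; what remains is a polynomial identity in [z], [w] and [z ^+ n.+1]. *)
have -> : z ^+ n = w * z ^+ n.+1 by rewrite exprS mulrA [w * z]mulrC zw mul1r.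
by rewrite [z ^+ n.+2]exprS; ring.
Qed.

Lemma triband_not_regular s r z w : `|z| = 1 -> z * w = 1 ->
  ~ regular_value (triband p1 s r) (r + s * (z + w)).
Proof.
move=> z1 zw [_ [M M0 TM] _].
have w1 : `|w| = 1 by have := normr1 R[i]; rewrite -zw normrM z1 mul1r.
(* The 3 counts the error terms of [triband_geometric], each of norm 1. *)
set C := complex.Re (M * (`|s| * 3)).
have normC n : lp_norm p (geometric_ell z n) <= C.
  have C0 : 0 <= M * (`|s| * 3) by rewrite !mulr_ge0.
  rewrite -lecR /C RRe_real ?ger0_real//.
  apply: le_trans (TM _ _ (triband_geometric s r z w n zw)) _.
  rewrite ler_wpM2l// normrZ ler_wpM2l//.
  have unit_delta c k : `|c| = 1 -> `|c *: delta k| <= 1.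
    by move=> c1; rewrite normrZ norm_delta c1 mulr1.
  have -> : 3 = 1 + 1 + 1 :> R[i] by ring.
  have zn1 m : `|z ^+ m| = 1 by rewrite normrX z1 expr1n.
  apply: le_trans (ler_normB _ _) _; apply: lerD; last exact: unit_delta.
  by apply: le_trans (ler_normB _ _) _; apply: lerD; exact: unit_delta.
have C0 : 0 <= C.
  by apply: le_trans (normC 0%N); rewrite [lp_norm]unlock powR_ge0.
(* Taking for [n] the integer part of [C]^ p[, the bound n + 1 <=]C [^ p] is absurd. *)
have := truncnS_gt (C `^ p); rewrite ltNge => /negP; apply.
apply: le_trans (lp_norm_geometric z _ z1) _.
by rewrite ge0_ler_powR ?nnegrE ?(ltW p0)// [lp_norm]unlock powR_ge0.
Qed.

End approximate_eigenvectors.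

Theorem theorem3p2 (R : realType) (p : R) (p1 : 1 < p) (r s : R[i]) :
  spectrum (triband (ltW p1) s r)
  = [set r + 2 * s * (cos theta)%:C | theta in `[0, 2 * pi]].
Proof.
apply/seteqP; split=> l.
- move=> lS; apply: contrapT => lN; apply: lS.
  have [t tI|a [z [a0 z1 -> ->]]] := triband_symbol_factor r s l.
    by apply/eqP => lE; apply: lN; exists t; rewrite ?lE.
  apply: (@contraction_product_regular _ _ _ ell_lshift ell_rshift l a z) => //.
  + exact: ell_lshift_contraction.
  + exact: ell_rshift_contraction.
  + exact: triband_factor.
- move=> [t _ <-].
  (* On the unit circle the inverse of [z] is its conjugate, and their sum is 2 cos t. *)
  set z := cos t +i* sin t.
  have zz : z * z^*%C = 1.
    by rewrite -[RHS]/(1 +i* 0) -(cos2Dsin2 t) /z; simpc; congr (_ +i* _); ring.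
  have -> : r + 2 * s * (cos t)%:C = r + s * (z + z^*%C).
    by rewrite addcJ /=; ring.
  apply: triband_not_regular => //.
  by apply/eqP; rewrite -sqrp_eq1 ?normr_ge0// sqr_normc zz.
Qed.
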